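(* Let $\Gamma$ be a class of topological spaces and assume $\mathtt{OGD}^{\mathbb{N}}(\Gamma)$. Suppose that $X$ and $Y$ are separable metric spaces, $X\in\Gamma$, and $\pi\colon X\to Y$ is Borel. Then exactly one of the following holds: (1) the function $\pi$ is $\sigma$-continuous with closed witnesses; (2) there is a continuous function $\psi\colon\mathrm{Ext}_{\mathbb{N}_*}(\mathbb{N}^{\mathbb{N}})\to X$ with the property that $\pi\circ\psi$ is a reduction of $\mathbb{N}^{\mathbb{N}}$ to a closed set and $(\pi\circ\psi)\upharpoonright\mathbb{N}^{\mathbb{N}}$ is continuous.
   Context: Base theory: $\mathsf{ZF}+\mathsf{DC}$. A function is Borel if preimages of open sets are Borel. $\pi\colon X\to Y$ is $\sigma$-continuous with closed witnesses if $X$ is the union of countably many closed sets on each of which $\pi$ is continuous (i.e., the restriction of $\pi$ is continuous). A reduction of a set $A\subseteq Z$ to a set $B\subseteq Y$ is a function $\phi\colon Z\to Y$ with $\phi(A)\subseteq B$ and $\phi(Z\setminus A)\subseteq Y\setminus B$; ''a reduction of $\mathbb{N}^{\mathbb{N}}$ to a closed set'' means a reduction of $\mathbb{N}^{\mathbb{N}}\subseteq\mathrm{Ext}_{\mathbb{N}_*}(\mathbb{N}^{\mathbb{N}})$ to some closed subset of $Y$. $\mathbb{N}_*=\mathbb{N}\cup\{\infty\}$ is the one-point compactification of $\mathbb{N}$. $\mathrm{Ext}_{\mathbb{N}_*}(\mathbb{N}^{\mathbb{N}})=\mathbb{N}^{\mathbb{N}}\cup\{t\cdot(\infty) : t\in\mathbb{N}^{<\mathbb{N}}\}$,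 with the topology generated by the sets $\{b : t\sqsubset b\text{ and }b(|t|)\in U\}$ for $t\in\mathbb{N}^{<\mathbb{N}}$ and $U\subseteq\mathbb{N}_*$ open ($\mathbb N^{<\mathbb N}$ denotes finite sequences, $\sqsubset$ strict extension, $|t|$ length, $t\cdot(x)$ is $t$ followed by the single entry $x$). Definition of $\mathtt{OGD}^{\mathbb{N}}(\Gamma)$: for every $Z\in\Gamma$ and every box-open $\mathbb{N}$-dimensional dihypergraph $H$ on $Z$, either $H$ has chromatic number at most $\aleph_0$ or there is a continuous homomorphism from $\mathbb{H}_{\mathbb{N}^{\mathbb{N}}}$ to $H$. Here an $\mathbb{N}$-dimensional dihypergraph on $Z$ is a subset of $Z^{\mathbb{N}}$ containing no constant sequence; it is box-open if it is open in the topology on $Z^{\mathbb{N}}$ generated by the sets $\prod_n U_n$ with all $U_n\subseteq Z$ open; a homomorphism from $R\subseteq W^{\mathbb{N}}$ to $S\subseteq Z^{\mathbb{N}}$ is a map $W\to Z$ sending, coordinatewise, elements of $R$ to elements of $S$; the chromatic number of $H$ is the least cardinal $\kappa$ for which there is a map from $Z$ to a set of cardinality $\kappa$ that is non-constant along every element of $H$; and $\mathbb{H}_{\mathbb{N}^{\mathbb{N}}}=\bigcup_{t\in\mathbb{N}^{<\mathbb{N}}}\prod_{n\in\mathbb{N}}\mathcal{N}_{t\cdot(n)}$, where $\mathcal{N}_s=\{b\in\mathbb{N}^{\mathbb{N}} : s\sqsubseteq b\}$. *)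

(* Defs.v *)
From HB Require Import structures.
From mathcomp Require Import all_boot all_order all_algebra.
From mathcomp Require Import boolp classical_sets functions cardinality reals.
From mathcomp Require Import topology measurable_structure.

Set Implicit Arguments.
Unset Strict Implicit.
Unset Printing Implicit Defensive.

Local Open Scope classical_set_scope.

Definition separable (T : topologicalType) : Prop :=
  exists2 D : set T, countable D & dense D.

Definition borel_function (X Y : topologicalType) (f : X -> Y) : Prop :=
  forall V : set Y, open V -> <<s (@open X) >> (f @^-1` V).

(* Finite and empty unions are covered by repeating a set or using set0. *)
Definition sigma_continuous_closed (X Y : topologicalType) (f : X -> Y) : Prop :=
  exists F : nat -> set X,
    [/\ forall n, closed (F n),
        \bigcup_n F n = [set: X]
      & forall n, {within F n, continuous f}].

Definition reduction (Z Y : Type) (A : set Z) (B : set Y) (phi : Z -> Y) : Prop :=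
  phi @` A `<=` B /\ phi @` (~` A) `<=` ~` B.

Definition baire : Type := prod_topology (fun _ : nat => nat).

HB.instance Definition _ := Topological.on baire.

Definition cylinder (s : seq nat) : set baire :=
  [set b | mkseq b (size s) = s].

Definition natstar : Type := one_point_compactification nat.

HB.instance Definition _ := Topological.on natstar.

(* [Branch b] is b itself and [Tip t] is the finite sequence t.(oo). *)
Inductive ext : Type :=
  | Branch of baire
  | Tip of seq nat.

HB.instance Definition _ := gen_eqMixin ext.
HB.instance Definition _ := gen_choiceMixin ext.

Definition ext_tip (t : seq nat) : seq natstar := rcons (map Some t) None.

(* For t with finite entries, extensions in [ext] are always strict: t.(oo)
   ends in oo (that is, [None]), which does not occur in t. *)
Definition ext_extends (t : seq nat) (x : ext) : Prop :=
  match x with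
  | Branch b => cylinder t b
  | Tip s => prefix (map Some t : seq natstar) (ext_tip s)
  end.

(* Meaningful only for i smaller than the length of x. *)
Definition ext_entry (x : ext) (i : nat) : natstar :=
  match x with
  | Branch b => Some (b i)
  | Tip s => nth None (ext_tip s) i
  end.

Definition ext_subbase : set_system ext :=
  [set V | exists (t : seq nat) (U : set natstar),
    open U /\ V = [set x | ext_extends t x /\ U (ext_entry x (size t))]].

HB.instance Definition _ := isSubBaseTopological.Build ext ext_subbase id.

(* The copy of the Baire space inside [ext]. *)
Definition ext_branches : set ext := range Branch.

Definition box_topology (Z : Type) : Type := nat -> Z.

Section box_topology_instance.
Variable Z : topologicalType.

Definition box_subbase : set_system (box_topology Z) :=
  [set V | exists2 U : nat -> set Z,
    forall n, open (U n) & V = [set z | forall n, U n (z n)]].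

HB.instance Definition _ := Choice.copy (box_topology Z) (nat -> Z).
HB.instance Definition _ :=
  isSubBaseTopological.Build (box_topology Z) box_subbase id.

End box_topology_instance.

Definition box_open (Z : topologicalType) (H : set (nat -> Z)) : Prop :=
  @open (box_topology Z) H.

Definition dihypergraph (Z : Type) (H : set (nat -> Z)) : Prop :=
  forall z : Z, ~ H (fun=> z).

Definition homomorphism (W Z : Type) (R : set (nat -> W)) (S : set (nat -> Z))
    (phi : W -> Z) : Prop :=
  forall w, R w -> S (phi \o w).

Definition coloring (Z K : Type) (H : set (nat -> Z)) (c : Z -> K) : Prop :=
  forall z, H z -> ~ exists k, forall n, c (z n) = k.

Definition countable_chromatic_number (Z : Type) (H : set (nat -> Z)) : Prop :=
  exists (K : Type) (c : Z -> K), countable [set: K] /\ coloring H c.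

Definition HNN : set (nat -> baire) :=
  [set b | exists t : seq nat, forall n, cylinder (rcons t n) (b n)].

Definition OGD (Gamma : topologicalType -> Prop) : Prop :=
  forall Z : topologicalType, Gamma Z ->
  forall H : set (nat -> Z), dihypergraph H -> box_open H ->
    countable_chromatic_number H \/
    exists phi : baire -> Z, continuous phi /\ homomorphism HNN H phi.

(* Main.v *)
Require Import Defs.
From HB Require Import structures.
From mathcomp Require Import all_boot all_order all_algebra finmap lra.
From mathcomp Require Import boolp classical_sets functions cardinality reals.
From mathcomp Require Import topology measurable_structure.

(* Both alternatives cannot hold, by the Baire category theorem: one of the
   countably many closed sets would contain the image of some cylinder and of
   its tip, and continuity there contradicts the reduction to a closed set.

   For existence, apply OGD to the dihypergraph [jump pi] of the families
   (x_(k,n)) in X with x_(k,n) -> y_k in n, y_k -> z and pi (y_k) bounded away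
   from pi z. Shrinking neighborhoods preserve limits, so it is box-open although
   pi is only Borel, and pi is continuous on every closed independent set; a
   countable coloring therefore yields (1). Otherwise let phi be a continuous
   homomorphism. As pi o phi is Borel, it is continuous on a comeager set G. Below
   every node t, either some y_k or z is a limit of branches of G whose images
   under pi o phi stay away from its own image. If this distance can be bounded
   below uniformly inside some cylinder, or pi o phi is constant on the trace on
   G of some cylinder, the closed set is a ball or a point. In the remaining case
   images of tips eventually lie near the images of the branches around them, and
   the children of each node are selected with a discrete set of images. *)

Set Implicit Arguments.
Unset Strict Implicit.
Unset Printing Implicit Defensive.

Import Order.TTheory GRing.Theory Num.Theory.

Local Open Scope classical_set_scope.

(** * The topologies of the Baire space and of [ext] *)

Lemma cylinderP (s : seq nat) (b : baire) :
  cylinder s b <-> forall i, i < size s -> b i = nth 0 s i.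
Proof.
split=> [bs i si|bs]; first by rewrite -[s in RHS]bs nth_mkseq.
by apply: (@eq_from_nth _ 0); rewrite size_mkseq// => i si; rewrite nth_mkseq ?bs.
Qed.

Lemma cylinder_mkseqP (b c : baire) (n : nat) :
  cylinder (mkseq b n) c <-> forall i, i < n -> c i = b i.
Proof.
rewrite cylinderP size_mkseq; split=> bc i ni; have := bc i ni;
  by rewrite nth_mkseq.
Qed.

Lemma cylinder_self (b : baire) (n : nat) : cylinder (mkseq b n) b.
Proof. exact/cylinder_mkseqP. Qed.

Lemma cylinder_prefix (s s' : seq nat) :
  prefix s s' -> cylinder s' `<=` cylinder s.
Proof.
move=> /prefixP[r ->] b /cylinderP bs; apply/cylinderP => i si.
by rewrite bs ?nth_cat ?si// size_cat ltn_addr.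
Qed.

Lemma prefix_mkseq (s : seq nat) (b : baire) (n : nat) :
  cylinder s b -> size s <= n -> prefix s (mkseq b n).
Proof.
move=> bs sn; rewrite prefixE; apply/eqP/(@eq_from_nth _ 0).
  by rewrite size_take size_mkseq; case: ltngtP sn.
rewrite size_take size_mkseq => i.
have -> : (if size s < n then size s else n) = size s by case: ltngtP sn.
move=> si; rewrite nth_take// nth_mkseq ?(leq_trans si)//.
by move/cylinderP: bs; apply.
Qed.

Definition seq_ext (s : seq nat) : baire := nth 0 s.

Lemma cylinder_seq_ext (s : seq nat) : cylinder s (seq_ext s).
Proof. exact/cylinderP. Qed.

(** The cylinders around [b] generate a filter that converges to [b] in each coordinate, hence in
    the product topology. *)
Lemma nbhs_baire (b : baire) (A : set baire) :
  nbhs b A -> exists n, cylinder (mkseq b n) `<=` A.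
Proof.
pose F := filter_from [set: nat] (fun n => cylinder (mkseq b n)).
have FF : Filter F.
  apply: filter_from_filter; first by exists 0.
  move=> i j _ _; exists (maxn i j) => // c /cylinder_mkseqP cb.
  by split; apply/cylinder_mkseqP => k ki; apply: cb;
    rewrite (leq_trans ki)// (leq_maxl, leq_maxr).
suff Fb : F --> b by move=> /Fb[n _ nA]; exists n.
apply/cvg_sup => i U [V [[W oW <-] Wb WU]]; exists i.+1 => // c /cylinder_mkseqP cb.
by apply: WU => /=; rewrite /= (cb i).
Qed.

Lemma open_ext (t : seq nat) (U : set natstar) : open U ->
  open [set x | ext_extends t x /\ U (ext_entry x (size t))].
Proof.
move=> oU; set V := (V in open V).
have sV : ext_subbase V by exists t, U.
exists [set V]; last by rewrite bigcup_set1.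
move=> _ ->; exists [fset V]%fset; first by move=> W /fset1P ->; rewrite in_setE.
by rewrite set_fset1 bigcap_set1.
Qed.

Lemma ext_cvg (F : set_system ext) (x : ext) : Filter F ->
  (forall t U, open U -> ext_extends t x -> U (ext_entry x (size t)) ->
    F [set y | ext_extends t y /\ U (ext_entry y (size t))]) ->
  F --> x.
Proof.
move=> FF sF A /=; rewrite nbhsE => -[_ [[B sB <-] [C BC Cx] sBA]].
apply: (@filterS _ _ _ C) => [y Cy|]; first by apply: sBA; exists C.
have [D sD DC] := sB _ BC; rewrite -DC; apply: filter_bigI => E DE.
have := Cx; rewrite -DC => /(_ E DE) /=.
by have /sD := DE; rewrite in_setE => -[t [U [oU ->]]] [tx Ux]; exact: sF.
Qed.

Lemma nbhs_Branch (b : baire) (A : set ext) : nbhs (Branch b) A ->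
  exists n, forall c, cylinder (mkseq b n) c -> A (Branch c).
Proof.
pose F := filter_from [set: nat] (fun n => Branch @` cylinder (mkseq b n)).
have FF : Filter F.
  apply: filter_from_filter; first by exists 0.
  move=> i j _ _; exists (maxn i j) => // _ [c /cylinder_mkseqP cb <-].
  by split; exists c => //; apply/cylinder_mkseqP => k ki; apply: cb;
    rewrite (leq_trans ki)// (leq_maxl, leq_maxr).
suff Fb : F --> Branch b.
  by move=> /Fb[n _ nA]; exists n => c cb; apply: nA; exists c.
apply: ext_cvg => t U oU tb Ub; exists (size t).+1 => //.
move=> _ [c /cylinder_mkseqP cb <-] /=; rewrite cb//; split=> //.
apply/cylinderP => i ti; rewrite cb; last exact: ltnW.
by move/cylinderP: tb; apply.
Qed.

Lemma open_natstar_None (U : set natstar) : open U -> U None ->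
  exists J, forall j, J <= j -> U (Some j).
Proof.
rewrite openE => oU /oU[K [cK _] KU].
have fK : exists J, forall j, K j -> j < J.
  (* Compactness bounds [K]: the near-covering form yields a single [n] above all its points. *)
  have /compact_near_coveringP cK' := cK.
  suff [n _ nK] : \forall n \near \oo, K `<=` (fun j => (j < n) : Prop).
    by exists n => j Kj; exact: (nK n (leqnn n) j Kj).
  apply: cK' => j Kj; exists ([set j], [set n | j < n]).
    by split; [rewrite /= nbhs_principalE; exact/principal_filterP|exists j.+1].
  by move=> [i n] [/= -> ?].
have [J KJ] := fK; exists J => j Jj; apply: KU; left; exists j => // /KJ.
by rewrite ltnNge Jj.
Qed.

Definition tail_nbhs (J : nat) : set natstar :=
  [set x | if x is Some j then J <= j else True].

Lemma open_tail_nbhs (J : nat) : open (tail_nbhs J).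
Proof.
rewrite openE => -[j /= Jj|_].
  change (nbhs j [set k | tail_nbhs J (Some k)]).
  by rewrite nbhs_principalE; exact/principal_filterP.
exists [set j | j < J]; first last.
  by move=> _ [[j /= /negP + <-]|->//]; rewrite -leqNgt.
split; last first.
  rewrite -[X in closed X]setCK; apply: open_closedC.
  by rewrite openE => x xJ; rewrite /interior nbhs_principalE; exact/principal_filterP.
by apply: finite_compact; exact: finite_II.
Qed.

Lemma prefix_map_Some (t s : seq nat) :
  prefix (map Some t : seq natstar) (ext_tip s) = prefix t s.
Proof.
rewrite /ext_tip; elim: t s => [|i t IH] [|j s]//=; rewrite ?prefix0s//.
by rewrite -IH.
Qed.

(** A subbasic set containing [Tip s] tests either an entry of [s], shared by all branches through
    [s], or the entry at position [size s], where openness at infinity excludes only finitely many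
    [j]. *)
Lemma nbhs_Tip (s : seq nat) (A : set ext) : nbhs (Tip s) A ->
  exists J, forall j c, J <= j -> cylinder (rcons s j) c -> A (Branch c).
Proof.
pose F := filter_from [set: nat]
  (fun J => [set y | exists j c, [/\ J <= j, cylinder (rcons s j) c & y = Branch c]]).
have FF : Filter F.
  apply: filter_from_filter; first by exists 0.
  move=> i j _ _; exists (maxn i j) => // _ [k [c [+ cs ->]]].
  by rewrite geq_max => /andP[ik jk]; split; exists k, c.
suff Fs : F --> Tip s.
  by move=> /Fs[J _ JA]; exists J => j c Jj cs; apply: JA; exists j, c.
apply: ext_cvg => t U oU /=; rewrite prefix_map_Some => ts.
have sts : size t <= size s by exact: size_prefix ts.
rewrite /ext_tip nth_rcons size_map.
case: ltnP => [lt|]; last first.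
  move=> ge; have {}ge : size t = size s by apply/eqP; rewrite eqn_leq sts.
  rewrite if_same => /(open_natstar_None oU)[J JU].
  exists J => // _ [j [c [Jj cs ->]]] /=; split.
    by apply: cylinder_prefix cs; apply: prefix_trans ts (prefix_rcons _ _).
  move/cylinderP: cs => /(_ (size t)); rewrite size_rcons ge leqnn nth_rcons.
  by rewrite ltnn eqxx => -> //; exact: JU.
rewrite (nth_map 0)// => Us; exists 0 => // _ [j [c [_ cs ->]]] /=; split.
  by apply: cylinder_prefix cs; apply: prefix_trans ts (prefix_rcons _ _).
move/cylinderP: cs => ->; last by rewrite size_rcons ltnW.
by rewrite nth_rcons lt.
Qed.

Lemma near_Branch (b : baire) (n : nat) :
  nbhs (Branch b) [set y | ext_extends (mkseq b n) y].
Proof.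
rewrite nbhsE; eexists.
  split; first exact: (@open_ext (mkseq b n) setT openT).
  by split=> //; exact: cylinder_self.
by move=> y [].
Qed.

Lemma near_Tip (s : seq nat) (J : nat) :
  nbhs (Tip s) [set y | y = Tip s \/
    exists j, J <= j /\ ext_extends (rcons s j) y].
Proof.
have ps : prefix s s by exact: prefix_refl.
rewrite nbhsE; eexists.
  split; first exact: (@open_ext s _ (@open_tail_nbhs J)).
  by rewrite /= prefix_map_Some; split=> //;
    rewrite /ext_tip nth_rcons size_map ltnn eqxx.
move=> y /=[]; case: y => [c cs Jc|u].
  right; exists (c (size s)); split=> //=; apply/cylinderP => i.
  rewrite size_rcons ltnS leq_eqVlt nth_rcons => /orP[/eqP->|si].
    by rewrite ltnn eqxx.
  by rewrite si; move/cylinderP: cs; apply.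
rewrite /= prefix_map_Some => /prefixP[r ->{u}].
case: r => [|j r]; first by rewrite cats0; left.
rewrite /ext_tip nth_rcons size_map size_cat /= addnS ltnS leq_addr.
rewrite (nth_map 0) ?size_cat/= ?addnS ?ltnS ?leq_addr// nth_cat ltnn subnn /=.
move=> Jj; right; exists j; split=> //.
by rewrite -cat_rcons prefix_map_Some prefix_prefix.
Qed.

(** * Baire category *)

Lemma limit_branch (u : nat -> seq nat) :
  (forall k, prefix (u k) (u k.+1)) -> (forall k, k <= size (u k)) ->
  exists b, forall k, cylinder (u k) b.
Proof.
move=> pu su; have pu' k l : prefix (u k) (u (k + l)).
  elim: l => [|l IH]; first by rewrite addn0 prefix_refl.
  by rewrite addnS; exact: prefix_trans (pu _).
exists (fun i => nth 0 (u i.+1) i) => k; apply/cylinderP => i ik.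
have nthp m n : m <= n -> i < size (u m) -> nth 0 (u m) i = nth 0 (u n) i.
  move=> mn im; rewrite -(subnKC mn).
  by have /prefixP[r ->] := pu' m (n - m); rewrite nth_cat im.
by case: (leqP i.+1 k) => [|/ltnW] ki; [exact: nthp|apply/esym; exact: nthp].
Qed.

Definition nowhere_dense (A : set baire) : Prop :=
  forall s, exists2 s', prefix s s' & forall b, cylinder s' b -> ~ A b.

Lemma nowhere_dense0 : nowhere_dense set0.
Proof. by move=> s; exists s; [exact: prefix_refl|move=> b _ []]. Qed.

Lemma nowhere_denseU (N : nat -> set baire) (n : nat) :
  (forall k, nowhere_dense (N k)) ->
  nowhere_dense [set b | exists2 k, k <= n & N k b].
Proof.
move=> nN; elim: n => [|n IH] s.
  have [s' ss' s'N] := nN 0 s; exists s' => // b /s'N N0 [k].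
  by rewrite leqn0 => /eqP ->.
have [s1 ss1 s1N] := nN n.+1 s; have [s2 s12 s2N] := IH s1.
exists s2; first exact: prefix_trans s12.
move=> b bs2 [k]; rewrite leq_eqVlt => /orP[/eqP->|].
  by apply: s1N; exact: cylinder_prefix bs2.
by rewrite ltnS => kn Nk; apply: (s2N b) => //; exists k.
Qed.

Lemma baire_category (N : nat -> set baire) (s : seq nat) :
  (forall k, nowhere_dense (N k)) ->
  exists2 b, cylinder s b & forall k, ~ N k b.
Proof.
move=> nN.
(* Appending [0] first makes the nodes grow strictly, so that they determine a branch. *)
have /choice[g gP] : forall p : nat * seq nat, exists s', prefix (rcons p.2 0) s' /\
    forall b, cylinder s' b -> ~ N p.1 b.
  by move=> [k t]; have [s' ? ?] := nN k (rcons t 0); exists s'.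
pose u := fix u k := if k is k'.+1 then g (k', u k') else s.
have pu k : prefix (u k) (u k.+1).
  by have [/= + _] := gP (k, u k); apply: prefix_trans; exact: prefix_rcons.
have su k : k <= size (u k).
  elim: k => // k IH; have [/= /size_prefix + _] := gP (k, u k).
  by apply: leq_trans; rewrite size_rcons.
have [b bu] := limit_branch pu su.
exists b => [|k]; first exact: (bu 0).
by have [_] := gP (k, u k); apply; exact: (bu k.+1).
Qed.

(** The first hypothesis says that each [A n] is closed. A closed set containing no cylinder is
    nowhere dense, so [baire_category] applies. *)
Lemma baire_cover (A : nat -> set baire) :
  (forall n b, ~ A n b -> exists m, forall c, cylinder (mkseq b m) c -> ~ A n c) ->
  (forall b, exists n, A n b) -> exists n s, cylinder s `<=` A n.
Proof.
move=> clA cov; apply: contrapT => nex.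
have nA n : nowhere_dense (A n).
  move=> s; have [b sb nAb] : exists2 b, cylinder s b & ~ A n b.
    apply: contrapT => h; apply: nex; exists n, s => b sb.
    by apply: contrapT => nAb; apply: h; exists b.
  have [m mA] := clA _ _ nAb; exists (mkseq b (maxn m (size s))).
    by apply: prefix_mkseq => //; exact: leq_maxr.
  move=> c /cylinder_mkseqP cb; apply: mA; apply/cylinder_mkseqP => i im.
  by apply: cb; rewrite (leq_trans im)// leq_maxl.
have [b _ nAb] := baire_category [::] nA.
by have [n /nAb] := cov b.
Qed.

(** * The Baire property of Borel preimages *)

Definition cylinder_open (U : set baire) : Prop :=
  forall b, U b -> exists n, cylinder (mkseq b n) `<=` U.

(* The Baire property. *)
Definition almost_open (A : set baire) : Prop :=
  exists (U : set baire) (N : nat -> set baire),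
    [/\ cylinder_open U, forall k, nowhere_dense (N k)
      & forall b, (forall k, ~ N k b) -> (A b <-> U b)].

Lemma open_almost_open (A : set baire) : cylinder_open A -> almost_open A.
Proof. by move=> oA; exists A, (fun=> set0); split=> // _; exact: nowhere_dense0. Qed.

Lemma almost_openC (A : set baire) : almost_open A -> almost_open (~` A).
Proof.
move=> [U [N [oU nN AU]]].
(* [V] is the exterior of [U]; the boundary, outside both, becomes the extra nowhere dense set of
   index [0]. *)
pose V := [set b | exists n, forall c, cylinder (mkseq b n) c -> ~ U c].
exists V, (fun k => if k is k'.+1 then N k' else [set b | ~ U b /\ ~ V b]); split.
- move=> b [n nU]; exists n => c cb; exists n => d dc; apply: nU.
  apply/cylinder_mkseqP => i ni; move/cylinder_mkseqP: dc => ->//.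
  by move/cylinder_mkseqP: cb => ->.
- case=> // s; have [[b sb Ub]|nU] := pselect (exists2 b, cylinder s b & U b).
    have [n bU] := oU b Ub; exists (mkseq b (maxn n (size s))).
      by apply: prefix_mkseq => //; exact: leq_maxr.
    move=> c /cylinder_mkseqP cb [+ _]; apply; apply: bU.
    by apply/cylinder_mkseqP => i im; apply: cb; rewrite (leq_trans im)// leq_maxl.
  exists s; first exact: prefix_refl.
  move=> c cs [_]; apply; exists (size s) => d /cylinder_mkseqP dc Ud; apply: nU.
  exists d => //; apply/cylinderP => i si; rewrite dc//.
  by move/cylinderP: cs; apply.
- move=> b bN; have AUb := AU b (fun k => bN k.+1).
  split=> [nA|[n nU]]; last by move/AUb; apply: nU; exact: cylinder_self.
  by apply: contrapT => nV; apply: (bN 0); split=> // /AUb.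
Qed.

Lemma almost_open_bigcup (A : nat -> set baire) :
  (forall i, almost_open (A i)) -> almost_open (\bigcup_i A i).
Proof.
move=> /choice[U /choice[N UN]].
exists (\bigcup_i U i), (fun m =>
  if (choice.unpickle m : option (nat * nat)) is Some ik
  then N ik.1 ik.2 else set0); split.
- move=> b [i _ Uib]; have [oU _ _] := UN i; have [n nU] := oU b Uib.
  by exists n => c /nU; exists i.
- move=> m; case: choice.unpickle => [[i k]|]; last exact: nowhere_dense0.
  by have [_ + _] := UN i; apply.
- move=> b bN; have AU i : A i b <-> U i b.
    have [_ _] := UN i; apply=> k.
    by have := bN (choice.pickle (i, k)); rewrite choice.pickleK.
  by split=> -[i _ /AU ?]; exists i.
Qed.

(** The sets with almost open preimage form a sigma-algebra that contains the open sets. *)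
Lemma borel_almost_open (X : topologicalType) (phi : baire -> X) (B : set X) :
  continuous phi -> <<s (@open X) >> B -> almost_open (phi @^-1` B).
Proof.
move=> cphi; move: B.
change (<<s (@open X) >> `<=` [set B | almost_open (phi @^-1` B)]).
apply: smallest_sub; first split.
- by rewrite /= preimage_set0; apply: open_almost_open.
- by move=> B /almost_openC; rewrite setTD.
- by move=> B aB; rewrite /= preimage_bigcup; exact: almost_open_bigcup.
- move=> B oB; apply: open_almost_open => b Bb; apply: nbhs_baire.
  by apply: cphi; rewrite nbhsE; exists B.
Qed.

Local Open Scope ring_scope.

(** * Metric estimates and generic continuity of Borel functions *)

Section metric.
Context {R : realType}.
Implicit Types X Y : metricType R.

Lemma continuous_baireP X (phi : baire -> X) : continuous phi ->
  forall b e, 0 < e -> exists n, forall c,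
    cylinder (mkseq b n) c -> mdist (phi b) (phi c) < e.
Proof.
move=> cphi b e e0.
have [|n nA] := @nbhs_baire b (phi @^-1` ball (phi b) e).
  by apply: cphi; exact: nbhsx_ballx.
by exists n => c /nA; rewrite /= ballEmdist.
Qed.

Lemma near_mdistP X (x : X) (A : set X) :
  nbhs x A <-> exists2 e, 0 < e & forall y, mdist x y < e -> A y.
Proof.
split=> [/nbhs_ballP[e e0 eA]|[e e0 eA]].
  by exists e => // y xy; apply: eA; rewrite ballEmdist.
by apply/nbhs_ballP; exists e => // y; rewrite ballEmdist => /eA.
Qed.

Lemma open_mball X (x : X) (r : R) : open [set y | mdist x y < r].
Proof.
rewrite openE => y /= xy; apply/near_mdistP; exists (r - mdist x y).
  by rewrite subr_gt0.
move=> z yz; apply: le_lt_trans (metric_triangle _ y _) _.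
by rewrite addrC -ltrBrDr.
Qed.

Lemma invS_lt (e : R) : 0 < e -> exists n : nat, n.+1%:R^-1 < e.
Proof.
move=> e0; exists (Num.truncn e^-1).
rewrite -[ltRHS]invrK ltf_pV2 ?posrE ?invr_gt0//.
by rewrite truncnS_gt.
Qed.

Lemma invS_le_lt (e : R) : 0 < e ->
  exists n : nat, forall m, (n <= m)%N -> m.+1%:R^-1 < e.
Proof.
move=> /invS_lt[n ne]; exists n => m nm; apply: le_lt_trans ne.
by rewrite lef_pV2 ?posrE// ler_nat ltnS.
Qed.

(** Countably many balls suffice to test continuity into [Y]. The preimage of each agrees with an
    open set off a meager set, and the union of these meager sets is discarded. *)
Lemma generic_continuity X Y (pi : X -> Y) (phi : baire -> X) :
  separable Y -> borel_function pi -> continuous phi ->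
  exists2 N : nat -> set baire, forall k, nowhere_dense (N k) &
    forall b e, (forall k, ~ N k b) -> 0 < e -> exists n, forall c,
      cylinder (mkseq b n) c -> (forall k, ~ N k c) ->
      mdist (pi (phi b)) (pi (phi c)) < e.
Proof.
move=> [D /countable_injP[f finj] dD] bpi cphi.
(* [B m j] is the ball of radius 1/(j+1) around the point of [D] with code [m], unique by [finj], or
   empty if there is none. *)
pose B (m j : nat) : set Y :=
  \bigcup_(d in [set d | D d /\ f d = m]) [set y | mdist d y < j.+1%:R^-1].
have oB m j : open (B m j) by apply: bigcup_open => d _; exact: open_mball.
have /choice[U /choice[N UN]] : forall p : nat * nat,
    almost_open ((pi \o phi) @^-1` B p.1 p.2).
  move=> [m j]; apply: (@borel_almost_open _ phi (pi @^-1` B m j) cphi).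
  exact: bpi.
pose N' l := if (choice.unpickle l : option (nat * nat * nat)) is Some pk
  then N pk.1 pk.2 else set0.
exists N' => [l|b e bN e0].
  rewrite /N'; case: choice.unpickle => [[p k]|]; last exact: nowhere_dense0.
  by have [_ + _] := UN p; apply.
have e20 : 0 < e / 2 by rewrite divr_gt0.
have [j je] := invS_lt e20.
have [d [bd Dd]] : [set y | mdist (pi (phi b)) y < j.+1%:R^-1] `&` D !=set0.
  apply: dD; last exact: open_mball.
  by exists (pi (phi b)); rewrite /= mdistxx invr_gt0.
have [oU _ AU] := UN (f d, j).
have NU c : (forall k, ~ N' k c) -> B (f d) j (pi (phi c)) <-> U (f d, j) c.
  move=> cN; apply: AU => k; have := cN (choice.pickle ((f d, j), k)).
  by rewrite /N' choice.pickleK.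
have [|n nU] := oU b.
  by apply/NU => //; exists d => //=; rewrite metric_sym.
exists n => c /nU cU cN; have /NU[//|d' [Dd' ff] /=] := cU.
have -> : d' = d by apply: finj => //; rewrite inE.
move=> dc; apply: le_lt_trans (metric_triangle _ d _) _.
by rewrite [e]splitr ltrD// (lt_trans _ je).
Qed.

End metric.

(** * The dihypergraph of jumps *)

Lemma not_sigma_continuous_and_reduction (X Y : topologicalType) (pi : X -> Y)
    (psi : ext -> X) (C : set Y) :
  sigma_continuous_closed pi -> continuous psi -> closed C ->
  reduction ext_branches C (pi \o psi) -> False.
Proof.
move=> [F [clF covF cF]] cpsi clC [psiC psinC].
(* The closed sets, pulled back to the branches, cover the Baire space, so one of them contains a
   whole cylinder. *)
have [||n [s sF]] := @baire_cover (fun n b => F n (psi (Branch b))).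
- move=> n b nF; have oF : open (~` F n) by exact: closed_openC.
  apply: (@nbhs_Branch b (psi @^-1` (~` F n))); apply: cpsi.
  by move: oF; rewrite openE; apply.
- move=> b; have : [set: X] (psi (Branch b)) by [].
  by rewrite -covF => -[n _ Fn]; exists n.
have sc j c : cylinder (rcons s j) c -> F n (psi (Branch c)).
  by move=> cs; apply: sF; apply: cylinder_prefix cs; exact: prefix_rcons.
have FT : F n (psi (Tip s)).
  apply: contrapT => nF; have oF : open (~` F n) by exact: closed_openC.
  have [|J JF] := @nbhs_Tip s (psi @^-1` (~` F n)).
    by apply: cpsi; move: oF; rewrite openE; apply.
  have cJ := cylinder_seq_ext (rcons s J).
  by apply: (JF J _ _ cJ) => //; exact: sc cJ.
have nCT : ~ C (pi (psi (Tip s))).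
  by apply: psinC; exists (Tip s) => // -[].
(* Continuity on [F n] at the image of the tip keeps nearby branch images in the open complement of
   [C], a contradiction. *)
have /subspace_continuousP/(_ _ FT) cT := cF n.
have oC : open (~` C) by exact: closed_openC.
have nbT : nbhs (psi (Tip s)) [set x | F n x -> ~ C (pi x)].
  by apply: (cT (~` C)); move: oC; rewrite openE; apply.
have [|J JF] := @nbhs_Tip s (psi @^-1` [set x | F n x -> ~ C (pi x)]).
  exact: cpsi nbT.
have cJ := cylinder_seq_ext (rcons s J).
apply: (JF J _ _ cJ) => //; first exact: sc cJ.
by apply: psiC; exists (Branch (seq_ext (rcons s J))) => //; exists (seq_ext (rcons s J)).
Qed.

Section jump.
Context {R : realType} (X Y : metricType R) (pi : X -> Y).

Definition tends (Z : metricType R) (u : nat -> Z) (l : Z) : Prop :=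
  forall e : R, 0 < e -> exists M, forall n, (M <= n)%N -> mdist l (u n) < e.

Lemma mdist_eq (Z : metricType R) (x y : Z) :
  (forall e, 0 < e -> mdist x y < e) -> x = y.
Proof.
move=> xy; apply/eqP; rewrite -[_ == _]negbK -mdist_gt0; apply/negP => /xy.
by rewrite ltxx.
Qed.

Definition pair_index (k n : nat) : nat := choice.pickle (k, n).

(* Coordinate [pair_index k n] carries the n-th term of a sequence converging
   to y_k, where y_k tends to z while pi (y_k) stays away from pi z. Being
   formulated through limits only, this is a box-open condition even though pi
   is arbitrary. *)
Definition jump : set (nat -> X) :=
  [set x | exists (y : nat -> X) (z : X) (e : R), [/\ 0 < e,
    forall k, tends (fun n => x (pair_index k n)) (y k), tends y z
    & forall k, e <= mdist (pi z) (pi (y k))]].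

Lemma dihypergraph_jump : dihypergraph jump.
Proof.
move=> x [y [z [e [e0 xy yz ez]]]].
have yx k : y k = x by apply: mdist_eq => d /(xy k)[M]; exact.
have zx : z = x by apply: mdist_eq => d /yz[M /(_ _ (leqnn M))]; rewrite yx.
by have := ez 0; rewrite yx zx mdistxx leNgt e0.
Qed.

(** Moving coordinate [pair_index k n] by less than 1/(n+1) changes no limit, so the same [y], [z]
    and [e] remain witnesses. *)
Lemma box_open_jump : box_open jump.
Proof.
pose rad i : R := if (choice.unpickle i : option (nat * nat)) is Some kn
  then kn.2.+1%:R^-1 else 1.
have rad0 i : 0 < rad i.
  by rewrite /rad; case: choice.unpickle => // kn; rewrite invr_gt0.
rewrite /box_open openE => x xH; rewrite /interior nbhsE.
pose B : set (box_topology X) := [set x' | forall i, mdist (x i) (x' i) < rad i].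
have sB : box_subbase B.
  by exists (fun i => [set z | mdist (x i) z < rad i]) => // i; exact: open_mball.
exists B; first (split; last by move=> i; rewrite mdistxx).
  exists [set B]; last by rewrite bigcup_set1.
  move=> _ ->; exists [fset B]%fset; first by move=> W /fset1P ->; rewrite in_setE.
  by rewrite set_fset1 bigcap_set1.
move=> x' xx'; have [y [z [e [e0 xy yz ez]]]] := xH.
exists y, z, e; split=> // k d d0.
have d20 : 0 < d / 2 by rewrite divr_gt0.
have [M MP] := xy k _ d20; have [M' MP'] := invS_le_lt d20.
exists (maxn M M') => n; rewrite geq_max => /andP[Mn M'n].
have := xx' (pair_index k n); rewrite /rad choice.pickleK /= => xx.
have := MP _ Mn; have := lt_trans xx (MP' _ M'n).
have := metric_triangle (y k) (x (pair_index k n)) (x' (pair_index k n)).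
by move=> /= *; lra.
Qed.

Lemma not_continuous_within (A : set X) (x : X) :
  ~ (pi @ within A (nbhs x) --> pi x) ->
  exists2 e, 0 < e & forall d, 0 < d ->
    exists y, [/\ A y, mdist x y < d & e <= mdist (pi x) (pi y)].
Proof.
move=> npi; apply: contrapT => nex; apply: npi => V /near_mdistP[e e0 eV].
apply/near_mdistP; apply: contrapT => nd; apply: nex; exists e => // d d0.
apply: contrapT => ny; apply: nd; exists d => // y xy Ay; apply: eV.
by rewrite ltNge; apply/negP => ey; apply: ny; exists y.
Qed.

(** The closures of the color classes are the closed witnesses. A discontinuity on one of them is
    witnessed by points of the closure; approximating these from the class gives a monochromatic
    element of [jump]. *)
Lemma sigma_continuous_of_coloring :
  countable_chromatic_number jump -> sigma_continuous_closed pi.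
Proof.
move=> [K [c [/countable_injP[f finj] col]]].
pose A n := [set x | f (c x) = n].
exists (fun n => closure (A n)); split=> [n||n]; first exact: closed_closure.
  by apply/seteqP; split=> // x _; exists (f (c x)) => //; exact: subset_closure.
apply/subspace_continuousP => z clz; apply: contrapT => /not_continuous_within.
move=> [e e0 /= eP].
have /choice[y yP] : forall k : nat, exists y,
    [/\ closure (A n) y, mdist z y < k.+1%:R^-1 & e <= mdist (pi z) (pi y)].
  by move=> k; apply: eP; rewrite invr_gt0.
have clA w : closure (A n) w -> forall d, 0 < d -> exists2 v, A n v & mdist w v < d.
  move=> clw d d0; have [|v [Av wv]] := clw [set v | mdist w v < d].
    by apply/near_mdistP; exists d.
  by exists v.
have /choice[v vP] : forall p : nat * nat, exists v,
    A n v /\ mdist (y p.1) v < p.2.+1%:R^-1.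
  move=> [k m]; have [/clA + _ _] := yP k.
  by move=> /(_ m.+1%:R^-1)[|v ? ?]; [rewrite invr_gt0|exists v].
(* Indices that code no pair must also carry a point of the class. *)
pose x i := if (choice.unpickle i : option (nat * nat)) is Some km then v km
  else v (0, 0)%N.
have xA i : f (c (x i)) = n.
  rewrite /x; case: choice.unpickle => [km|]; first by have [] := vP km.
  by have [] := vP (0, 0)%N.
apply: (col x); last first.
  by exists (c (x 0)) => i; apply: finj; rewrite ?inE// !xA.
exists y, z, e; split=> // [k d d0|d d0|k]; last by have [] := yP k.
  have [M MP] := invS_le_lt d0; exists M => m /MP; apply: lt_trans.
  by rewrite /x choice.pickleK; have [] := vP (k, m).
have [M MP] := invS_le_lt d0; exists M => k /MP; apply: lt_trans.
by have [] := yP k.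
Qed.

End jump.

(** * Tips *)

(** The homomorphism can be tested on every choice of branches through the children of [t].
    Interleaving two choices forces their limits to agree, which upgrades convergence along one
    choice to convergence uniform over the cylinders. *)
Lemma jump_uniform {R : realType} (X Y : metricType R) (pi : X -> Y)
    (phi : baire -> X) (t : seq nat) :
  homomorphism HNN (jump pi) phi ->
  exists (y : nat -> X) (z : X) (e : R), [/\ 0 < e,
    forall k d, 0 < d -> exists M, forall n, (M <= n)%N ->
      forall b, cylinder (rcons t (pair_index k n)) b -> mdist (y k) (phi b) < d,
    tends y z & forall k, e <= mdist (pi z) (pi (y k))].
Proof.
move=> hom; pose b0 i := seq_ext (rcons t i).
have b0t i : cylinder (rcons t i) (b0 i) by exact: cylinder_seq_ext.
have [|y [z [e [e0 xy yz ez]]]] := hom b0; first by exists t.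
exists y, z, e; split=> // k d d0.
(* The parities are treated separately: while bad branches sit at one parity, the other keeps the
   limit equal to [y k]. *)
suff par p : exists M, forall n, (M <= n)%N -> odd n = p ->
    forall b, cylinder (rcons t (pair_index k n)) b -> mdist (y k) (phi b) < d.
  have [M0 M0P] := par false; have [M1 M1P] := par true.
  exists (maxn M0 M1) => n; rewrite geq_max => /andP[nM0 nM1].
  by case on : (odd n); [exact: M1P|exact: M0P].
apply: contrapT => nM.
(* A sequence of branches agreeing with b0 at the indices of parity ~~ p and
   violating the bound infinitely often at those of parity p. *)
have /choice[w wP] : forall i, exists b, cylinder (rcons t i) b /\
    forall n, i = pair_index k n ->
      (odd n <> p -> b = b0 i) /\
      (odd n = p -> (exists2 b', cylinder (rcons t i) b' & d <= mdist (y k) (phi b')) ->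
        d <= mdist (y k) (phi b)).
  move=> i; have pinj n m : pair_index k n = pair_index k m -> n = m.
    by move=> /(pcan_inj choice.pickleK)[].
  have [[n [ni np [b' b't db']]]|nex] := pselect (exists n, [/\ i = pair_index k n,
      odd n = p & exists2 b', cylinder (rcons t i) b' & d <= mdist (y k) (phi b')]).
    exists b'; split=> // m mi; have -> : m = n by apply: pinj; rewrite -mi.
    by split.
  exists (b0 i); split=> // n ni; split=> // np ex.
  by exfalso; apply: nex; exists n.
have wt i : cylinder (rcons t i) (w i) by have [] := wP i.
have [|y' [z' [e' [e'0 xy' yz' ez']]]] := hom w; first by exists t.
have yy' : y' k = y k.
  apply: mdist_eq => c c0; have c20 : 0 < c / 2 by rewrite divr_gt0.
  have [M MP] := xy k _ c20; have [M' MP'] := xy' k _ c20.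
  (* This [n] is large and of parity [~~ p], so [w] and [b0] agree there and both limits are close
     to the same point. *)
  pose n := ((maxn M M').*2 + ~~ p)%N.
  have Mn : (maxn M M' <= n)%N.
    by rewrite /n -addnn -addnA leq_addr.
  have np : odd n <> p by rewrite /n oddD odd_double; case: (p).
  move: (Mn); rewrite geq_max => /andP[{}/MP + /MP'] /=.
  have [_ /(_ n erefl)[/(_ np) -> _]] := wP (pair_index k n).
  have := metric_triangle (y' k) (phi (b0 (pair_index k n))) (y k).
  by rewrite (metric_sym (phi _) (y k)) => *; lra.
have [M MP] := xy' k d d0; apply: nM; exists M => n Mn np b bt.
rewrite ltNge; apply/negP => db.
have [_ /(_ n erefl)[_ /(_ np) dw]] := wP (pair_index k n).
by have := MP n Mn; rewrite yy' ltNge dw//; exists b.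
Qed.

Section tips.
Context {R : realType} (X Y : metricType R) (pi : X -> Y) (phi : baire -> X).
Variables (N : nat -> set baire) (nN : forall k, nowhere_dense (N k)).

Let G : set baire := [set b | forall k, ~ N k b].
Let g : baire -> Y := pi \o phi.

Hypothesis gG : forall b e, G b -> 0 < e -> exists n, forall c,
  cylinder (mkseq b n) c -> G c -> mdist (g b) (g c) < e.

Lemma generic_shrink (s : seq nat) (b : baire) (e : R) :
  cylinder s b -> G b -> 0 < e ->
  exists s', [/\ prefix s s', cylinder s' b &
    forall c, cylinder s' c -> G c -> mdist (g b) (g c) < e].
Proof.
move=> sb Gb /(gG Gb)[n nP]; exists (mkseq b (maxn n (size s))); split.
- by apply: prefix_mkseq => //; exact: leq_maxr.
- exact: cylinder_self.
- move=> c /cylinder_mkseqP cb; apply: nP; apply/cylinder_mkseqP => i ni.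
  by apply: cb; rewrite (leq_trans ni)// leq_maxl.
Qed.

Lemma generic_point (s : seq nat) : exists2 b, cylinder s b & G b.
Proof. exact: baire_category. Qed.

(* The point z can be the value at t.(oo) of a map on [ext] whose branches lie
   in G: branches accumulate at z while their images stay d-far from pi z. *)
Definition is_tip (t : seq nat) (z : X) (d : R) : Prop :=
  0 < d /\ exists s : nat -> seq nat, [/\
    forall j, prefix t (s j) /\ (size t < size (s j))%N,
    forall e, 0 < e -> exists J, forall j, (J <= j)%N ->
      forall b, cylinder (s j) b -> mdist z (phi b) < e
    & forall j b, cylinder (s j) b -> G b -> d <= mdist (pi z) (g b)].

(** Generic branches are taken close to each [y k]. If for some [k] their images stay away from
    [pi (y k)] infinitely often, [y k] is the tip value; otherwise one branch per [k], with image
    near [pi (y k)], makes [z] the tip value. *)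
Lemma exists_tip (t : seq nat) : homomorphism HNN (jump pi) phi ->
  exists z d, is_tip t z d.
Proof.
move=> /(@jump_uniform _ _ _ _ _ t)[y [z [e [e0 xy yz ez]]]].
(* [sb (k, n)] is a node below the child of index [pair_index k n], with a generic branch from whose
   image the other generic images below that node differ by less than 1/(n+1). *)
have /choice[sb sbP] : forall p : nat * nat, exists sb : seq nat * baire,
    [/\ prefix (rcons t (pair_index p.1 p.2)) sb.1, cylinder sb.1 sb.2, G sb.2 &
      forall c, cylinder sb.1 c -> G c -> mdist (g sb.2) (g c) < p.2.+1%:R^-1].
  move=> [k n]; have [b bs Gb] := generic_point (rcons t (pair_index k n)).
  have [|s [ss sb sP]] := @generic_shrink _ b n.+1%:R^-1 bs Gb.
    by rewrite invr_gt0.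
  by exists (s, b).
have tsb p : prefix t (sb p).1 /\ (size t < size (sb p).1)%N.
  have [ps _ _ _] := sbP p; split.
    by apply: prefix_trans ps; exact: prefix_rcons.
  by have := size_prefix ps; rewrite size_rcons.
have sbt p b : cylinder (sb p).1 b -> cylinder (rcons t (pair_index p.1 p.2)) b.
  by have [ps _ _ _] := sbP p; exact: cylinder_prefix.
have [[k [d [d0 far]]]|near] := pselect (exists k d, 0 < d /\
    forall M, exists2 n, (M <= n)%N & d <= mdist (pi (y k)) (g (sb (k, n)).2)).
  have d20 : 0 < d / 2 by rewrite divr_gt0.
  have [M MP] := invS_le_lt d20.
  have /choice[nj njP] : forall j, exists n, (maxn M j <= n)%N /\
      d <= mdist (pi (y k)) (g (sb (k, n)).2).
    by move=> j; have [n ? ?] := far (maxn M j); exists n.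
  exists (y k), (d / 2); split=> //; exists (fun j => (sb (k, nj j)).1); split=> //.
  - move=> c c0; have [J JP] := xy k c c0; exists J => j Jj b /sbt.
    apply: JP; apply: leq_trans Jj _; have [+ _] := njP j.
    by apply: leq_trans; exact: leq_maxr.
  - move=> j b bs Gb; have [_ _ _ /(_ b bs Gb)] := sbP (k, nj j).
    have [jn dn] := njP j; move=> /= small.
    have := lt_trans small (MP _ (leq_trans (leq_maxl _ _) jn)).
    have := metric_triangle (pi (y k)) (g b) (g (sb (k, nj j)).2).
    by rewrite (metric_sym (g b)); move: dn => *; lra.
have e40 : 0 < e / 4 by rewrite divr_gt0.
have [M MP] := invS_le_lt e40.
have /choice[nk nkP] : forall k, exists n, [/\ (M <= n)%N,
    forall b, cylinder (rcons t (pair_index k n)) b -> mdist (y k) (phi b) < k.+1%:R^-1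
    & mdist (pi (y k)) (g (sb (k, n)).2) < e / 4].
  move=> k; have [|J JP] := xy k k.+1%:R^-1; first by rewrite invr_gt0.
  have [L LP] : exists L, forall n, (L <= n)%N ->
      mdist (pi (y k)) (g (sb (k, n)).2) < e / 4.
    apply: contrapT => nL; apply: near; exists k, (e / 4); split=> // L.
    apply: contrapT => nn; apply: nL; exists L => n Ln; rewrite ltNge.
    by apply/negP => en; apply: nn; exists n.
  exists (maxn M (maxn J L)); split; first exact: leq_maxl.
    by apply: JP; rewrite !leq_max leqnn orbT.
  by apply: LP; rewrite !leq_max leqnn !orbT.
(* Of the distance [e] from [pi z] to [pi (y k)], one [e / 4] is lost in passing to the chosen
   branch and another within its node. *)
exists z, (e / 2); split; first by rewrite divr_gt0.
exists (fun k => (sb (k, nk k)).1); split=> //.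
- move=> c c0; have c20 : 0 < c / 2 by rewrite divr_gt0.
  have [J JP] := yz _ c20; have [L LP] := invS_le_lt c20.
  exists (maxn J L) => k; rewrite geq_max => /andP[/JP Jk /LP Lk] b /sbt bt.
  have [_ /(_ b bt) bk _] := nkP k.
  have := lt_trans bk Lk; have := metric_triangle z (y k) (phi b).
  by move: Jk => *; lra.
- move=> k b bs Gb; have [_ _ _ /(_ b bs Gb)] := sbP (k, nk k).
  have [Mk _ ek] := nkP k; move=> /= small.
  have := lt_trans small (MP _ Mk); have := ez k.
  have := metric_triangle (pi z) (g b) (pi (y k)).
  have := metric_triangle (g b) (g (sb (k, nk k)).2) (pi (y k)).
  rewrite (metric_sym (g b) (g _)) (metric_sym (g (sb (k, nk k)).2) (pi _)).
  by move: ek => *; lra.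
Qed.

End tips.

(** * Construction of the reduction from a tree scheme *)

Lemma mkseq_cons (T : Type) (f : nat -> T) (n : nat) :
  mkseq f n.+1 = f 0%N :: mkseq (f \o succn) n.
Proof. by rewrite /mkseq /= (iotaDl 1 0) -map_comp. Qed.

(** The second alternative, isolated because three different constructions establish it. *)
Definition reduces_to_closed (X Y : topologicalType) (pi : X -> Y) : Prop :=
  exists psi : ext -> X,
  [/\ continuous psi,
      exists2 C : set Y, closed C & reduction ext_branches C (pi \o psi)
    & {within ext_branches, continuous (pi \o psi)}].

Section scheme.
Context {R : realType} (X Y : metricType R) (pi : X -> Y) (phi : baire -> X).
(** [c t j] is the [j]-th child of the node [t], [zf t] the value at its tip, and [good] the
    invariant of a construction. Children of [t] avoid [N k] for [k <= size t], which puts the limit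
    branches into [G]. *)
Variables (N : nat -> set baire) (t0 : seq nat) (zf : seq nat -> X)
  (c : seq nat -> nat -> seq nat) (good : seq nat -> Prop).

Let G : set baire := [set b | forall k, ~ N k b].

Hypothesis cphi : continuous phi.
Hypothesis gG : forall b e, G b -> 0 < e -> exists n, forall d,
  cylinder (mkseq b n) d -> G d -> mdist (pi (phi b)) (pi (phi d)) < e.
Hypothesis good0 : good t0.
Hypothesis goodc : forall t j, good t -> [/\ good (c t j), prefix t (c t j),
  (size t < size (c t j))%N &
  forall b, cylinder (c t j) b -> forall k, (k <= size t)%N -> ~ N k b].
Hypothesis cvgc : forall t e, good t -> 0 < e -> exists J, forall j, (J <= j)%N ->
  forall b, cylinder (c t j) b -> mdist (zf t) (phi b) < e.
Hypothesis sep : forall u, exists2 r, 0 < r & forall beta x, G x ->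
  (forall n, cylinder (foldl c t0 (mkseq beta n)) x) ->
  r <= mdist (pi (zf (foldl c t0 u))) (pi (phi x)).

Let th u := foldl c t0 u.

Let th_rcons u j : th (rcons u j) = c (th u) j.
Proof. by rewrite /th foldl_rcons. Qed.

Let good_th u : good (th u).
Proof.
by elim/last_ind: u => // u j IH; rewrite th_rcons; have [] := goodc j IH.
Qed.

Let prefix_th u v : prefix (th u) (th (u ++ v)).
Proof.
elim/last_ind: v => [|v j IH]; first by rewrite cats0 prefix_refl.
rewrite -rcons_cat th_rcons; apply: prefix_trans IH _.
by have [] := goodc j (good_th (u ++ v)).
Qed.

Let size_th u : (size u <= size (th u))%N.
Proof.
elim/last_ind: u => // u j IH; rewrite th_rcons size_rcons.
by have [_ _ + _] := goodc j (good_th u); apply: leq_ltn_trans.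
Qed.

(** A branch goes to [phi] of the limit of its nodes, a tip to the value of [zf] at its node. The
    closed set is the closure of the branch images, and [sep] keeps every tip image out of it. *)
Lemma reduction_of_scheme : reduces_to_closed pi.
Proof.
have /choice[Th ThP] : forall beta : baire, exists b, forall n,
    cylinder (th (mkseq beta n)) b.
  move=> beta; apply: limit_branch => k; last first.
    by have := size_th (mkseq beta k); rewrite size_mkseq.
  by rewrite mkseqS -cats1; exact: prefix_th.
have ThG beta : G (Th beta).
  move=> k; have := ThP beta k.+1; rewrite mkseqS th_rcons => cT.
  have [_ _ _ /(_ _ cT)] := goodc (beta k) (good_th (mkseq beta k)).
  by apply; have := size_th (mkseq beta k); rewrite size_mkseq.
have Thn beta n : cylinder (th (mkseq beta n)) `<=` cylinder (mkseq (Th beta) n).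
  move=> b /cylinderP bt; apply/cylinder_mkseqP => i ni.
  have nt : (i < size (th (mkseq beta n)))%N.
    by apply: leq_trans ni _; have := size_th (mkseq beta n); rewrite size_mkseq.
  by rewrite bt//; have /cylinderP -> := ThP beta n.
have Thv v beta : cylinder v beta -> cylinder (th v) (Th beta).
  by move=> vb; have := ThP beta (size v); rewrite vb.
pose psi (x : ext) := match x with Branch beta => phi (Th beta)
  | Tip u => zf (th u) end.
(* The value at a tip below [v] is a limit of points [phi b] with [b] below [th v], so the strict
   bound becomes a weak one. *)
have psi_near v y p r : ext_extends v y ->
    (forall b, cylinder (th v) b -> mdist p (phi b) < r) -> mdist p (psi y) <= r.
  case: y => [beta vb|s] pr; first by apply/ltW/pr/Thv.
  move: pr; rewrite /= prefix_map_Some => /prefixP[w ->] pr.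
  apply/ler_addgt0Pr => e e0; have [J JP] := cvgc (good_th (v ++ w)) e0.
  have cJ := cylinder_seq_ext (c (th (v ++ w)) J).
  have := JP J (leqnn J) _ cJ; set b := seq_ext _ => zb.
  have pb : mdist p (phi b) < r.
    apply: pr; apply: cylinder_prefix (prefix_th v w) _ _.
    by apply: cylinder_prefix cJ; have [] := goodc J (good_th (v ++ w)).
  have := metric_triangle p (phi b) (zf (th (v ++ w))).
  by rewrite (metric_sym (phi b)) => *; lra.
exists psi; split.
- move=> x V /near_mdistP[e e0 eV]; have e20 : 0 < e / 2 by rewrite divr_gt0.
  case: x eV => [beta|u] eV.
    have [n nP] := continuous_baireP cphi (Th beta) e20.
    apply: filterS (near_Branch beta n) => y ye; apply: eV.
    apply: (@le_lt_trans _ _ (e / 2)); last by lra.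
    by apply: psi_near ye _ => b /Thn; exact: nP.
  have [J JP] := cvgc (good_th u) e20.
  apply: filterS (near_Tip u J) => y [->|[j [Jj ye]]]; apply: eV.
    by rewrite mdistxx.
  apply: (@le_lt_trans _ _ (e / 2)); last by lra.
  by apply: psi_near ye _ => b; rewrite th_rcons; exact: JP.
- exists (closure (range (fun beta => pi (phi (Th beta))))).
    exact: closed_closure.
  split=> [_ [_ [beta _ <-] <-]|_ [[beta|u] ux <-]].
  + by apply: subset_closure; exists beta.
  + by exfalso; apply: ux; exists beta.
  + have [r r0 rP] := sep u => clu.
    have [|_ [[beta _ <-] /=]] := clu [set y | mdist (pi (psi (Tip u))) y < r].
      by apply/near_mdistP; exists r.
    by rewrite ltNge (rP beta)//; exact: ThP.
- apply/subspace_continuousP => _ [beta _ <-] V /near_mdistP[e e0 eV].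
  have [n nP] := gG (ThG beta) e0.
  apply: filterS (near_Branch beta n) => y ye [gamma _ yg]; apply: eV.
  rewrite -yg; apply: nP; last exact: ThG.
  by apply: Thn; apply: Thv; move: ye; rewrite -yg.
Qed.

End scheme.

(** * Selection of discrete sequences *)

Section discrete.
Context {R : realType} (Y : metricType R).

Lemma positive_lower_bound (f : nat -> R) (P : nat -> Prop) (M : nat) :
  (forall j, P j -> 0 < f j) ->
  exists2 r, 0 < r & forall j, (j < M)%N -> P j -> r <= f j.
Proof.
move=> f0; elim: M => [|M [r r0 rP]]; first by exists 1.
have [PM|nPM] := pselect (P M).
  exists (Num.min r (f M)); first by rewrite lt_min r0 f0.
  move=> j; rewrite ltnS leq_eqVlt => /orP[/eqP->|jM] Pj.
    by rewrite ge_min lexx orbT.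
  by rewrite ge_min rP.
exists r => // j; rewrite ltnS leq_eqVlt => /orP[/eqP->//|jM].
exact: rP.
Qed.

(* If some a_m is a limit of other terms, terms approaching a_m geometrically
   fast form a discrete set; otherwise all of {a_j} is discrete. *)
Lemma discrete_selection (A : nat -> set Y) :
  (forall j (L : seq Y), exists2 q, A j q & ~ q \in L) ->
  exists (J : nat -> nat) (q : nat -> Y) (r : nat -> R),
    (forall k, [/\ (k <= J k)%N, A (J k) (q k) & 0 < r k]) /\
    forall k l, k != l -> r k <= mdist (q k) (q l).
Proof.
move=> infA.
have /choice[f fP] : forall p : nat * seq Y, exists q, A p.1 q /\ ~ q \in p.2.
  by move=> [j L]; have [q ? ?] := infA j L; exists q.
(* [Ls n] lists the earlier terms, so that each new term differs from all of them. *)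
pose Ls := fix Ls n := if n is n'.+1 then f (n', Ls n') :: Ls n' else [::].
pose a n := f (n, Ls n).
have aA n : A n (a n) by have [] := fP (n, Ls n).
have aL i n : (i < n)%N -> a i \in Ls n.
  elim: n => // n IH; rewrite ltnS leq_eqVlt in_cons => /orP[/eqP->|/IH->].
    by rewrite eqxx.
  by rewrite orbT.
have a_lt i n : (i < n)%N -> a i != a n.
  by move=> /aL ain; apply/eqP => an; have [_] := fP (n, Ls n); rewrite -/(a n) -an.
have a_inj i n : i != n -> 0 < mdist (a i) (a n).
  by rewrite mdist_gt0 neq_ltn => /orP[|/a_lt]; [exact: a_lt|rewrite eq_sym].
have [[m lim]|nolim] := pselect (exists m, forall e M, 0 < e ->
    exists j, [/\ (M <= j)%N, j != m & mdist (a m) (a j) < e]).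
  have /choice[h hP] : forall p : R * nat, exists j, 0 < p.1 ->
      [/\ (p.2 <= j)%N, j != m & mdist (a m) (a j) < p.1].
    move=> [e M]; have [e0|ne0] := pselect (0 < e); last by exists 0.
    by have [j jP] := lim e M e0; exists j.
  (* Each step more than halves the distance to [a m], so any two selected terms are further apart
     than half the distance of either to [a m]. The argument [n'.+1] ensures [k <= J k]. *)
  pose J := fix J n := if n is n'.+1 then h (mdist (a m) (a (J n')) / 2, n'.+1)
    else h (1, 0%N).
  have Jm n : J n != m.
    elim: n => [|n IH]; first by have [] := hP (1, 0%N) ltr01.
    by have [] := hP (mdist (a m) (a (J n)) / 2, n.+1);
      rewrite //= divr_gt0// a_inj// eq_sym.
  have D0 n : 0 < mdist (a m) (a (J n)) by rewrite a_inj// eq_sym.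
  have JS n : (n < J n.+1)%N /\
      mdist (a m) (a (J n.+1)) < mdist (a m) (a (J n)) / 2.
    by have [] := hP (mdist (a m) (a (J n)) / 2, n.+1); rewrite //= divr_gt0.
  have Jlt k l : (k < l)%N -> mdist (a m) (a (J l)) < mdist (a m) (a (J k)) / 2.
    elim: l => // l IH; rewrite ltnS leq_eqVlt => /orP[/eqP->|/IH kl].
      by have [] := JS l.
    by have [_ +] := JS l; have := D0 l; move: kl => *; lra.
  exists J, (a \o J), (fun k => mdist (a m) (a (J k)) / 2); split=> [k|k l] /=.
    split=> //; last by rewrite divr_gt0.
    by case: k => // k; have [] := JS k.
  rewrite neq_ltn => /orP[/Jlt|/Jlt]; have := D0 k; have := D0 l.
    have := metric_triangle (a m) (a (J l)) (a (J k)).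
    by rewrite (metric_sym (a (J l))) => *; lra.
  have := metric_triangle (a m) (a (J k)) (a (J l)).
  by move=> *; lra.
(* Without such a limit point each term is isolated: a bound valid from some index on is combined
   with the minimum of finitely many positive distances. *)
exists id, a; suff /choice[r rP] : forall k, exists r, 0 < r /\
    forall l, k != l -> r <= mdist (a k) (a l).
  by exists r; split=> [k|k]; have [] := rP k.
move=> m; have [e [M [e0 eP]]] : exists e M, 0 < e /\ forall j, (M <= j)%N ->
    j != m -> e <= mdist (a m) (a j).
  apply: contrapT => nex; apply: nolim; exists m => e M e0.
  apply: contrapT => nj; apply: nex; exists e, M; split=> // j Mj jm.
  by rewrite leNgt; apply/negP => aj; apply: nj; exists j.
have [r r0 rP] := @positive_lower_bound (fun j => mdist (a m) (a j))
  (fun j => m != j) M (a_inj m).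
exists (Num.min e r); split=> [|j mj]; first by rewrite lt_min e0.
rewrite ge_min; case: (ltnP j M) => [/rP/(_ mj) ->|/eP ejm].
  by rewrite orbT.
by rewrite ejm// eq_sym.
Qed.

End discrete.

(** * Choice of the tree scheme *)

Section reduction.
Context {R : realType} (X Y : metricType R) (pi : X -> Y) (phi : baire -> X).
Variables (N : nat -> set baire) (nN : forall k, nowhere_dense (N k)).

Let G : set baire := [set b | forall k, ~ N k b].
Let g : baire -> Y := pi \o phi.

Hypothesis cphi : continuous phi.
Hypothesis hom : homomorphism HNN (jump pi) phi.
Hypothesis gG : forall b e, G b -> 0 < e -> exists n, forall c,
  cylinder (mkseq b n) c -> G c -> mdist (g b) (g c) < e.

Let tip := is_tip pi phi N.

(** Common to the three constructions: the nodes [s j] are lengthened to leave finitely many sets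
    [N k] and then to meet the requirement [P] of the case; convergence to [z] passes to longer
    nodes. *)
Lemma extend_children (t : seq nat) (z : X) (s : nat -> seq nat)
    (P : nat -> seq nat -> Prop) :
  (forall j, prefix t (s j) /\ (size t < size (s j))%N) ->
  (forall e, 0 < e -> exists J, forall j, (J <= j)%N ->
    forall b, cylinder (s j) b -> mdist z (phi b) < e) ->
  (forall j s1, prefix (s j) s1 -> exists2 s2, prefix s1 s2 & P j s2) ->
  exists c : nat -> seq nat, [/\
    forall j, [/\ prefix (s j) (c j), P j (c j), prefix t (c j),
      (size t < size (c j))%N &
      forall b, cylinder (c j) b -> forall k, (k <= size t)%N -> ~ N k b]
    & forall e, 0 < e -> exists J, forall j, (J <= j)%N ->
      forall b, cylinder (c j) b -> mdist z (phi b) < e].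
Proof.
move=> ts sz sP.
have /choice[c cP] : forall j, exists c, [/\ prefix (s j) c, P j c &
    forall b, cylinder c b -> forall k, (k <= size t)%N -> ~ N k b].
  move=> j; have [s1 ss1 s1N] := nowhere_denseU (size t) nN (s j).
  have [s2 s12 Ps2] := sP j s1 ss1; exists s2; split=> //.
    exact: prefix_trans s12.
  move=> b bs2 k kt Nk; apply: (s1N b); last by exists k.
  exact: cylinder_prefix bs2.
exists c; split=> [j|e e0].
  have [sc Pc cN] := cP j; have [tsj tsz] := ts j; split=> //.
    exact: prefix_trans sc.
  exact: leq_trans tsz (size_prefix sc).
have [J JP] := sz e e0; exists J => j Jj b cb; apply: (JP j) => //.
by have [sc _ _] := cP j; exact: cylinder_prefix cb.
Qed.

Let x0 : X := phi (seq_ext [::]).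

(** Below [s1] generic images lie within [e / 4] of [g b0], hence within [e / 2] of each other. A
    tip image [e]-far from one of them is thus [e / 2]-far from all. *)
Lemma reduction_of_uniform_tips (s0 : seq nat) (e : R) : 0 < e ->
  (forall s, prefix s0 s -> exists2 t, prefix s t & exists z, tip t z e) ->
  reduces_to_closed pi.
Proof.
move=> e0 tips; have [b0 sb0 Gb0] := generic_point nN s0.
have e40 : 0 < e / 4 by rewrite divr_gt0.
have [s1 [s01 sb1 s1P]] := generic_shrink gG sb0 Gb0 e40.
pose good t := prefix s1 t /\ exists z, tip t z e.
have /choice[zc zcP] : forall t, exists zc : X * (nat -> seq nat), good t -> [/\
    forall j, [/\ good (zc.2 j), prefix t (zc.2 j), (size t < size (zc.2 j))%N &
      forall b, cylinder (zc.2 j) b -> forall k, (k <= size t)%N -> ~ N k b],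
    forall d, 0 < d -> exists J, forall j, (J <= j)%N ->
      forall b, cylinder (zc.2 j) b -> mdist zc.1 (phi b) < d
    & forall j b, cylinder (zc.2 j) b -> G b -> e <= mdist (pi zc.1) (g b)].
  move=> t; have [gt|ngt] := pselect (good t); last by exists (x0, fun=> [::]).
  have [s1t [z [_ [s [ts sz sd]]]]] := gt.
  have [|c [cP cz]] := @extend_children t z s (fun _ => good) ts sz.
    move=> j s' ss'; have s1s' : prefix s1 s'.
      by apply: prefix_trans ss'; have [tsj _] := ts j; exact: prefix_trans tsj.
    have [t' st' t't] := tips s' (prefix_trans s01 s1s').
    by exists t' => //; split=> //; exact: prefix_trans st'.
  exists (z, c) => _; split=> //= j; first by have [_ ? ? ? ?] := cP j; split.
  by move=> b cb; apply: (sd j); have [sc _ _ _ _] := cP j; exact: cylinder_prefix cb.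
have [t1 s1t1 t1t] := tips s1 s01.
apply: (@reduction_of_scheme _ _ _ pi phi N t1 (fst \o zc) (fun t => (zc t).2) good) => //.
- by move=> t j /zcP[+ _ _]; apply.
- by move=> t d /zcP[_ + _] d0; apply.
move=> u; set t := foldl _ _ _.
have gt : good t.
  rewrite /t; elim/last_ind: u {t} => [|u j IH]; first by [].
  by rewrite foldl_rcons; have [/(_ j)[]] := zcP _ IH.
exists (e / 2); first by rewrite divr_gt0.
move=> beta x Gx xP.
have x1 : cylinder s1 x by apply: cylinder_prefix s1t1 _ _; exact: (xP 0%N).
have [zcj _ far] := zcP _ gt.
have [b bc Gb] := generic_point nN ((zc t).2 0%N).
have b1 : cylinder s1 b.
  have [_ tc _ _] := zcj 0%N; have [s1t _] := gt.
  by apply: cylinder_prefix bc; exact: prefix_trans tc.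
have := far 0%N b bc Gb; have := s1P b b1 Gb; have := s1P x x1 Gx.
have := metric_triangle (pi (zc t).1) (g x) (g b).
have := metric_triangle (g x) (g b0) (g b).
by rewrite (metric_sym (g x) (g b0)) /= -/(g x) => *; lra.
Qed.

Hypothesis no_uniform_tips : forall s e, 0 < e ->
  exists2 s', prefix s s' & forall t z, prefix s' t -> ~ tip t z e.

(** A tip image has positive distance from some generic images, and these all equal [p]. *)
Lemma reduction_of_locally_constant (s0 : seq nat) (p : Y) :
  (forall b, cylinder s0 b -> G b -> g b = p) -> reduces_to_closed pi.
Proof.
move=> gp; pose good t := prefix s0 t.
have /choice[zc zcP] : forall t, exists zc : X * (nat -> seq nat), good t -> [/\
    forall j, [/\ good (zc.2 j), prefix t (zc.2 j), (size t < size (zc.2 j))%N &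
      forall b, cylinder (zc.2 j) b -> forall k, (k <= size t)%N -> ~ N k b],
    forall d, 0 < d -> exists J, forall j, (J <= j)%N ->
      forall b, cylinder (zc.2 j) b -> mdist zc.1 (phi b) < d
    & pi zc.1 <> p].
  move=> t; have [gt|ngt] := pselect (good t); last by exists (x0, fun=> [::]).
  have [z [d [d0 [s [ts sz sd]]]]] := exists_tip nN gG t hom.
  have [|c [cP cz]] := @extend_children t z s (fun _ => good) ts sz.
    move=> j s' ss'; exists s'; first exact: prefix_refl.
    by apply: prefix_trans ss'; have [tsj _] := ts j; exact: prefix_trans tsj.
  exists (z, c) => _; split=> //= [j|zp]; first by have [_ ? ? ? ?] := cP j; split.
  have [b sb Gb] := generic_point nN (s 0%N).
  have gbp : g b = p.
    apply: gp => //; apply: cylinder_prefix sb; have [tsj _] := ts 0%N.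
    exact: prefix_trans tsj.
  have : d <= mdist (pi z) (g b) := sd 0%N b sb Gb.
  by rewrite gbp zp mdistxx leNgt d0.
apply: (@reduction_of_scheme _ _ _ pi phi N s0 (fst \o zc) (fun t => (zc t).2) good) => //.
- exact: prefix_refl.
- by move=> t j /zcP[+ _ _]; apply.
- by move=> t d /zcP[_ + _] d0; apply.
move=> u; set t := foldl _ _ _.
have gt : good t.
  rewrite /t; elim/last_ind: u {t} => [|u j IH]; first exact: prefix_refl.
  by rewrite foldl_rcons; have [/(_ j)[]] := zcP _ IH.
have [_ _ zp] := zcP _ gt.
exists (mdist (pi (zc t).1) p); first by rewrite mdist_gt0; exact/eqP.
move=> beta x Gx xP; suff gxp : pi (phi x) = p by rewrite gxp.
by apply: gp => //; apply: cylinder_prefix (xP 0%N); exact: prefix_refl.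
Qed.

Hypothesis nowhere_constant : forall s p,
  exists b, [/\ cylinder s b, G b & g b <> p].

(** Below every node some generic branch avoids a given value, and generic continuity keeps [g] off
    that value nearby. *)
Lemma avoid_finite (L : seq Y) (s : seq nat) :
  exists2 s', prefix s s' & forall b, cylinder s' b -> G b -> ~ g b \in L.
Proof.
elim: L => [|p L [s1 ss1 s1L]]; first by exists s => //; exact: prefix_refl.
have [b [sb Gb /eqP gbp]] := nowhere_constant s1 p.
have [|s2 [s12 sb2 s2P]] := @generic_shrink _ _ _ pi phi N gG _ b (mdist (g b) p) sb Gb.
  by rewrite mdist_gt0.
exists s2; first exact: prefix_trans s12.
move=> c sc Gc; rewrite in_cons => /orP[/eqP gcp|gcL].
  by have := s2P c sc Gc; rewrite -/(g c) gcp ltxx.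
by apply: (s1L c) => //; exact: cylinder_prefix sc.
Qed.

(** Child [j] is shrunk twice around a selected value [q j]: to keep generic images within [r j / 8]
    of it, and to exclude tips of constant [r j / 8], which by [tip_near] brings the tip images
    close to [q j] as well. *)
Lemma discrete_children (t : seq nat) :
  exists (z : X) (d : R) (c : nat -> seq nat) (q : nat -> Y) (r : nat -> R), [/\
    tip t z d,
    forall j, [/\ prefix t (c j), (size t < size (c j))%N &
      forall b, cylinder (c j) b -> forall k, (k <= size t)%N -> ~ N k b],
    forall e, 0 < e -> exists J, forall j, (J <= j)%N ->
      forall b, cylinder (c j) b -> mdist z (phi b) < e,
    forall j b, cylinder (c j) b -> G b -> d <= mdist (pi z) (g b)
    & [/\ forall j, 0 < r j, forall i j, i != j -> r i <= mdist (q i) (q j),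
        forall j b, cylinder (c j) b -> G b -> mdist (q j) (g b) < r j / 8
      & forall j t' z', prefix (c j) t' -> ~ tip t' z' (r j / 8)]].
Proof.
have [z [d tt]] := exists_tip nN gG t hom; have [d0 [s [ts sz sd]]] := tt.
(* By [avoid_finite] no finite list contains all generic images below [s j]. *)
have [j L|J [q [r [JP rP]]]] :=
    @discrete_selection R Y (fun j => [set q | exists b, [/\ cylinder (s j) b, G b & q = g b]]).
  have [s' ss' s'L] := avoid_finite L (s j).
  have [b s'b Gb] := generic_point nN s'; exists (g b); last exact: s'L.
  by exists b; split=> //; exact: cylinder_prefix s'b.
have r8 j : 0 < r j / 8 by have [_ _ ?] := JP j; rewrite divr_gt0.
have /choice[s1 s1P] : forall j, exists s1, prefix (s (J j)) s1 /\
    forall b, cylinder s1 b -> G b -> mdist (q j) (g b) < r j / 8.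
  move=> j; have [_ [b [sb Gb ->]] _] := JP j.
  by have [s1 [? ? ?]] := generic_shrink gG sb Gb (r8 j); exists s1.
pose P j s' := (forall b, cylinder s' b -> G b -> mdist (q j) (g b) < r j / 8) /\
  forall t' z', prefix s' t' -> ~ tip t' z' (r j / 8).
have [||j s2 s12|c [cP cz]] := @extend_children t z s1 P.
- move=> j; have [sj _] := s1P j; have [tsj tsz] := ts (J j); split.
    exact: prefix_trans sj.
  exact: leq_trans tsz (size_prefix sj).
- move=> e e0; have [K KP] := sz e e0; exists K => j Kj b sb; apply: (KP (J j)).
    by have [jJ _ _] := JP j; exact: leq_trans jJ.
  by have [sj _] := s1P j; exact: cylinder_prefix sb.
- have [s3 s23 s3P] := no_uniform_tips s2 (r8 j); exists s3 => //; split=> // b sb.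
  have [_] := s1P j; apply; apply: cylinder_prefix sb.
  exact: prefix_trans s23.
exists z, d, c, q, r; split=> //.
- by move=> j; have [_ _ ? ? ?] := cP j.
- move=> j b cb; apply: (sd (J j)); have [s1c _ _ _ _] := cP j.
  by have [sj _] := s1P j; apply: cylinder_prefix cb; exact: prefix_trans s1c.
- split=> // [j|j b|j]; first by have [] := JP j.
  + by have [_ [+ _] _ _ _] := cP j; apply.
  + by have [_ [_ +] _ _ _] := cP j; apply.
Qed.

(** If all generic images below [t] were [e]-far from [pi z], the nodes that witness the constant
    [d] would also witness [e]. *)
Lemma tip_near (t : seq nat) (z : X) (d e : R) : tip t z d -> 0 < e ->
  ~ tip t z e -> exists b, [/\ cylinder t b, G b & mdist (pi z) (g b) < e].
Proof.
move=> [_ [s [ts sz _]]] e0 nt; apply: contrapT => nb; apply: nt.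
split=> //; exists s; split=> // j b sb Gb; rewrite leNgt; apply/negP => lt.
apply: nb; exists b; split=> //.
by apply: cylinder_prefix sb; have [] := ts j.
Qed.

(* A tip below the i-th child of t has its image near q t i, hence away from the
   images of the branches through the other children of t. *)
Lemma reduction_of_nowhere_constant : reduces_to_closed pi.
Proof.
have /choice[zf /choice[df /choice[c /choice[q /choice[r zcP]]]]] := discrete_children.
apply: (@reduction_of_scheme _ _ _ pi phi N [::] zf c (fun=> True)) => //.
- by move=> t j _; have [_ /(_ j)[? ? ?] _ _ _] := zcP t.
- by move=> t e _ e0; have [_ _ + _ _] := zcP t; apply.
have pre_t t u : prefix t (foldl c t u).
  elim: u t => [|i u IH] t /=; first exact: prefix_refl.
  by apply: prefix_trans (IH _); have [_ /(_ i)[? _ _] _ _ _] := zcP t.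
(* The node [t] is generalized because the induction on [u] passes to a child. *)
suff sep : forall u t, exists2 r, 0 < r & forall beta x, G x ->
    (forall n, cylinder (foldl c t (mkseq beta n)) x) ->
    r <= mdist (pi (zf (foldl c t u))) (pi (phi x)) by move=> u; exact: sep.
elim=> [|i u IH] t.
  have [[d0 _] _ _ far _] := zcP t; exists (df t) => // beta x Gx xP.
  exact: (far (beta 0%N) x (xP 1%N) Gx).
have [h h0 hP] := IH (c t i).
have [_ _ _ _ [r0 qr cq cn]] := zcP t.
(* [h] serves the branches through the same child [i], [r t i / 2] those through another child. *)
exists (Num.min h (r t i / 2)); first by rewrite lt_min h0 divr_gt0.
move=> beta x Gx xP; rewrite ge_min /=.
have [bi|bi] := eqVneq (beta 0%N) i.
  rewrite (hP (beta \o succn))// => n.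
  by have := xP n.+1; rewrite mkseq_cons /= bi.
apply/orP; right; set t' := foldl c (c t i) u.
have [tt' _ _ _ _] := zcP t'.
have ri0 := r0 i; have r80 : 0 < r t i / 8 by rewrite divr_gt0.
have [b [bt Gb zb]] := tip_near tt' r80 (cn _ _ _ (pre_t (c t i) u)).
have := cq i b (cylinder_prefix (pre_t _ _) bt) Gb.
have := cq (beta 0%N) x (xP 1%N) Gx.
(* Both radii are at most the distance of the two selected values, so three errors of an eighth of a
   radius leave five eighths of that distance, more than [r t i / 2]. *)
have := qr _ _ bi; have := qr i (beta 0%N); rewrite eq_sym => /(_ bi).
have := metric_triangle (q t i) (g b) (q t (beta 0%N)).
have := metric_triangle (g b) (pi (zf t')) (q t (beta 0%N)).
have := metric_triangle (pi (zf t')) (g x) (q t (beta 0%N)).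
move: zb; rewrite (metric_sym (g b) (pi _)) (metric_sym (g x) (q _ _)).
rewrite (metric_sym (q t (beta 0%N)) (q t i)) -/(g x) => *; lra.
Qed.

End reduction.

(** * Combination of the three cases and the dichotomy *)

Lemma reduction_of_homomorphism {R : realType} (X Y : metricType R) (pi : X -> Y)
    (phi : baire -> X) :
  separable Y -> borel_function pi -> continuous phi ->
  homomorphism HNN (jump pi) phi ->
  reduces_to_closed pi.
Proof.
move=> sepY bpi cphi hom.
have [N nN gG] := generic_continuity sepY bpi cphi.
have [[s0 [e [e0 tips]]]|ntips] := pselect (exists s0 e, 0 < e /\
    forall s, prefix s0 s -> exists2 t, prefix s t & exists z, is_tip pi phi N t z e).
  exact: (reduction_of_uniform_tips nN cphi gG e0 tips).
have [[s0 [p gp]]|nconst] := pselect (exists s0 p, forall b, cylinder s0 b ->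
    (forall k, ~ N k b) -> pi (phi b) = p).
  exact: (reduction_of_locally_constant nN cphi hom gG gp).
apply: (reduction_of_nowhere_constant nN cphi hom gG).
- move=> s e e0; apply: contrapT => nex; apply: ntips; exists s, e; split=> // s' ss'.
  apply: contrapT => nt; apply: nex; exists s' => // t z s't tz.
  by apply: nt; exists t => //; exists z.
- move=> s p; apply: contrapT => nb; apply: nconst; exists s, p => b sb Gb.
  by apply: contrapT => gb; apply: nb; exists b.
Qed.

Theorem theorem5p2 (R : realType) (Gamma : topologicalType -> Prop)
    (hGamma : OGD Gamma) (X Y : metricType R)
    (sepX : separable X) (sepY : separable Y) (GammaX : Gamma X)
    (pi : X -> Y) (borel_pi : borel_function pi) :
  let alt1 := sigma_continuous_closed pi in
  let alt2 := exists psi : ext -> X,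
    [/\ continuous psi,
        exists2 C : set Y, closed C & reduction ext_branches C (pi \o psi)
      & {within ext_branches, continuous (pi \o psi)}] in
  (alt1 \/ alt2) /\ ~ (alt1 /\ alt2).
Proof.
move=> alt1 alt2; split; last first.
  move=> [a1 [psi [cpsi [C clC redC] _]]].
  exact: not_sigma_continuous_and_reduction a1 cpsi clC redC.
have [col|[phi [cphi hom]]] :=
    hGamma X GammaX _ (@dihypergraph_jump _ _ _ pi) (@box_open_jump _ _ _ pi).
  by left; exact: sigma_continuous_of_coloring.
by right; exact: reduction_of_homomorphism hom.
Qed.
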